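(* Let $E,F$ be vector lattices with $F$ Dedekind complete and such that the order dual $F^{\sim}$ separates the points of $F$. Let $T\in\mathcal{U}(E,F)$ be a rank one operator, i.e. $T=\varphi\otimes u$ for some $\varphi\in\mathcal{U}(E,\mathbb{R})$ and $u\in F$. If $T\in\Phi_1(\mathcal{U}(E,F))$, then $\varphi\in\Phi_1(\mathcal{U}(E,\mathbb{R}))$ and $u\in\Phi_1(F)$.
   Context: For vector lattices $E,F$, an operator $T\colon E\to F$ (not necessarily linear) is orthogonally additive if $T(x+y)=T(x)+T(y)$ whenever $|x|\wedge|y|=0$, and order bounded if it maps order bounded sets into order bounded sets. $\mathcal{U}(E,F)$ is the set of all orthogonally additive order bounded operators $E\to F$ (abstract Uryson operators), ordered by $S\le T$ iff $S(x)\le T(x)$ for all $x\in E$; it is a Dedekind complete vector lattice when $F$ is Dedekind complete. For $\varphi\in\mathcal{U}(E,\mathbb{R})$ and $u\in F$, the operator $\varphi\otimes u$ is defined by $(\varphi\otimes u)(x)=\varphi(x)u$ for $x\in E$. $F^{\sim}$ is the order dual of $F$ (the order bounded linear functionals on $F$); it separates the points of $F$ if for each $0\ne y\in F$ there is $f\in F^{\sim}$ with $f(y)\ne0$. In an Archimedean vector lattice $G$, an element $g\in G$ is finite if there is $z\in G$ such that for every $x\in G$ there is a number $c_x>0$ with $|x|\wedge n|g|\le c_x z$ for all $n\in\mathbb{N}$. $\Phi_1(G)$ is the set of all finite elements of $G$.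
   Formalization: The formal theorem takes ''rank one'' to include T ≠ 0 (so φ ≠ 0 and u ≠ 0); without this the claim fails, since φ = 0 with a non-finite u (e.g. u of infinite support in F = ℓ²) gives T = 0, which is finite. *)

(* Defs.v *)
From HB Require Import structures.
From mathcomp Require Import all_boot all_order all_algebra.
From mathcomp Require Import boolp classical_sets functions reals.

Set Implicit Arguments.
Unset Strict Implicit.
Unset Printing Implicit Defensive.

Import Order.TTheory GRing.Theory Num.Theory.

Local Open Scope ring_scope.
Local Open Scope classical_set_scope.

(* The lattice operations are fields of the mixin, rather than inherited from
   [Order.Lattice], because Hierarchy Builder does not accept a new join of
   [Order.Lattice] and [GRing.Zmodule] below [Num.RealDomain]. *)
HB.mixin Record isVectorLattice (R : realType) V
    of GRing.Lmodule R V & Num.POrderedZmodule V := {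
  vmeet : V -> V -> V;
  vjoin : V -> V -> V;
  vl_lexI : forall x y z : V, (x <= vmeet y z) = (x <= y) && (x <= z);
  vl_leUx : forall x y z : V, (vjoin x y <= z) = (x <= z) && (y <= z);
  vl_leD2r : forall z x y : V, x <= y -> x + z <= y + z;
  vl_leZ : forall (a : R) (x y : V), 0 <= a -> x <= y -> a *: x <= a *: y
}.

#[short(type="vectorLatticeType")]
HB.structure Definition VectorLattice (R : realType) :=
  { V of GRing.Lmodule R V & Num.POrderedZmodule V & isVectorLattice R V }.

HB.mixin Record isDedekindComplete (R : realType) V of VectorLattice R V := {
  vl_sup_exists : forall A : set V,
    A !=set0 -> has_ubound A -> supremums A !=set0
}.

#[short(type="dedekindVectorLatticeType")]
HB.structure Definition DedekindVectorLattice (R : realType) :=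
  { V of VectorLattice R V & isDedekindComplete R V }.

Section RealVectorLattice.
Variable R : realType.

Fact real_lexI_subproof (x y z : R^o) : (x <= Num.min y z) = (x <= y) && (x <= z).
Proof. exact: le_min. Qed.

Fact real_leUx_subproof (x y z : R^o) : (Num.max x y <= z) = (x <= z) && (y <= z).
Proof. exact: ge_max. Qed.

Fact real_leD2r_subproof (z x y : R^o) : x <= y -> x + z <= y + z.
Proof. by rewrite lerD2r. Qed.

Fact real_leZ_subproof (a : R) (x y : R^o) : 0 <= a -> x <= y -> a *: x <= a *: y.
Proof. by move=> a0 xy; apply: (@ler_wpM2l R). Qed.

HB.instance Definition _ := Order.POrder.copy R^o R.
HB.instance Definition _ := isVectorLattice.Build R R^o
  real_lexI_subproof real_leUx_subproof real_leD2r_subproof real_leZ_subproof.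

Fact real_sup_exists_subproof (A : set R^o) :
  A !=set0 -> has_ubound A -> supremums A !=set0.
Proof.
move=> A0 ubA; exists (sup (A : set R)); split.
- by move=> x Ax; apply: (@ub_le_sup R).
- by move=> x xA; apply: (@ge_sup R).
Qed.

HB.instance Definition _ := isDedekindComplete.Build R R^o
  real_sup_exists_subproof.

End RealVectorLattice.

Section VectorLatticeDefs.
Context {R : realType}.

Definition vabs {V : vectorLatticeType R} (x : V) : V := vjoin x (- x).

Definition vdisjoint {V : vectorLatticeType R} (x y : V) : Prop :=
  vmeet (vabs x) (vabs y) = 0.

Definition order_bounded_set {V : vectorLatticeType R} (A : set V) : Prop :=
  has_lbound A /\ has_ubound A.

Definition order_bounded {E F : vectorLatticeType R} (T : E -> F) : Prop :=
  forall A : set E, order_bounded_set A -> order_bounded_set (T @` A).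

Definition orthogonally_additive {E F : vectorLatticeType R} (T : E -> F)
    : Prop :=
  forall x y : E, vdisjoint x y -> T (x + y) = T x + T y.

(* The order dual of [F] consists of the order bounded linear functionals. *)
Definition order_dual_separates_points (F : vectorLatticeType R) : Prop :=
  forall y : F, y != 0 ->
    exists f : {linear F -> R^o}, order_bounded f /\ f y != 0.

(* Used for Archimedean [V]; every Dedekind complete vector lattice is
   Archimedean. *)
Definition finite_elements (V : vectorLatticeType R) : set V :=
  [set g | exists z : V, forall x : V, exists2 c : R, 0 < c &
    forall n : nat, vmeet (vabs x) (vabs g *+ n) <= c *: z].

End VectorLatticeDefs.

Arguments finite_elements {R} V _.

Section VectorLatticeTheory.
Variables (R : realType) (V : vectorLatticeType R).
Implicit Types (x y z u v w : V) (a : R).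

Lemma vl_leUl x y : x <= vjoin x y.
Proof. by have := lexx (vjoin x y); rewrite vl_leUx => /andP[]. Qed.

Lemma vl_leUr x y : y <= vjoin x y.
Proof. by have := lexx (vjoin x y); rewrite vl_leUx => /andP[]. Qed.

Lemma vl_leIl x y : vmeet x y <= x.
Proof. by have := lexx (vmeet x y); rewrite vl_lexI => /andP[]. Qed.

Lemma vl_leIr x y : vmeet x y <= y.
Proof. by have := lexx (vmeet x y); rewrite vl_lexI => /andP[]. Qed.

Lemma vjoinC x y : vjoin x y = vjoin y x.
Proof. by apply/le_anti; rewrite !vl_leUx !vl_leUl !vl_leUr. Qed.

Lemma vmeetC x y : vmeet x y = vmeet y x.
Proof. by apply/le_anti; rewrite !vl_lexI !vl_leIl !vl_leIr. Qed.

Lemma vl_leI2 x y u v : x <= u -> y <= v -> vmeet x y <= vmeet u v.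
Proof.
by move=> xu yv; rewrite vl_lexI (le_trans (vl_leIl _ _) xu)
  (le_trans (vl_leIr _ _) yv).
Qed.

Lemma vl_leD2 x y u v : x <= y -> u <= v -> x + u <= y + v.
Proof.
move=> xy uv; apply: (le_trans (vl_leD2r u _ _ xy)).
by rewrite ![y + _]addrC; exact: vl_leD2r.
Qed.

Lemma vl_subr_ge0 x y : (0 <= y - x) = (x <= y).
Proof.
apply/idP/idP => [/(vl_leD2r x)|/(vl_leD2r (- x))].
  by rewrite add0r subrK.
by rewrite subrr.
Qed.

Lemma vl_leBlDr x y z : (x - y <= z) = (x <= z + y).
Proof. by rewrite -[LHS]vl_subr_ge0 -[RHS]vl_subr_ge0 opprB addrA. Qed.

Lemma vl_leBrDr x y z : (x <= z - y) = (x + y <= z).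
Proof.
by rewrite -[LHS]vl_subr_ge0 -[RHS]vl_subr_ge0 opprD addrA addrAC.
Qed.

Lemma vl_leN2 x y : (- x <= - y) = (y <= x).
Proof. by rewrite -[LHS]vl_subr_ge0 opprK addrC vl_subr_ge0. Qed.

Lemma vl_leNl x y : (- x <= y) = (- y <= x).
Proof. by rewrite -[y in LHS]opprK vl_leN2. Qed.

Lemma vl_leDl x y : 0 <= y -> x <= x + y.
Proof. by move=> y0; rewrite -{1}[x]addr0; exact: vl_leD2. Qed.

Lemma vl_addr_ge0 x y : 0 <= x -> 0 <= y -> 0 <= x + y.
Proof. by move=> x0 y0; rewrite -[0]addr0; exact: vl_leD2. Qed.

Lemma vabs_ge x : x <= vabs x. Proof. exact: vl_leUl. Qed.

Lemma vabs_geN x : - x <= vabs x. Proof. exact: vl_leUr. Qed.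

Lemma vabs_le x y : (vabs x <= y) = (- y <= x) && (x <= y).
Proof. by rewrite vl_leUx andbC vl_leNl. Qed.

Lemma vabs_ge0 x : 0 <= vabs x.
Proof.
have : 0 <= vabs x + vabs x.
  by rewrite -(subrr x); apply: vl_leD2; [exact: vabs_ge|exact: vabs_geN].
have h2 : 0 <= (2^-1 : R) by rewrite invr_ge0 ler0n.
move=> /(vl_leZ _ _ _ h2); rewrite scaler0 -mulr2n -scaler_nat scalerA.
by rewrite mulVf ?scale1r ?pnatr_eq0.
Qed.

Lemma vabsN x : vabs (- x) = vabs x.
Proof. by rewrite /vabs opprK vjoinC. Qed.

Lemma vabs0 : vabs (0 : V) = 0.
Proof. by apply/le_anti; rewrite vabs_ge0 vl_leUx oppr0 lexx. Qed.

Lemma vabs_eq0 x : vabs x = 0 -> x = 0.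
Proof.
move=> x0; apply/le_anti; rewrite -{1}x0 vabs_ge /=.
by rewrite -vl_leN2 oppr0 -x0 vabs_geN.
Qed.

Lemma vabs_triangle x y : vabs (x + y) <= vabs x + vabs y.
Proof. by rewrite vl_leUx opprD !vl_leD2 ?vabs_ge ?vabs_geN. Qed.

Lemma vabsZ_le a x : vabs (a *: x) <= `|a| *: vabs x.
Proof.
have [a0|a0] := ler0P a.
  by rewrite vl_leUx -scaleNr -[a *: x]opprK -scalerN -scaleNr
    !vl_leZ ?oppr_ge0 ?vabs_ge ?vabs_geN.
by rewrite vl_leUx -scalerN !vl_leZ ?vabs_ge ?vabs_geN ?ltW.
Qed.

Lemma vmeetD_le u v w : 0 <= u -> 0 <= v -> 0 <= w ->
  vmeet u (v + w) <= vmeet u v + vmeet u w.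
Proof.
move=> u0 v0 w0; set m := vmeet u (v + w).
have mu : m <= u by exact: vl_leIl.
have mvw : m <= v + w by exact: vl_leIr.
rewrite -vl_leBlDr vl_lexI !vl_leBlDr.
rewrite ![_ + vmeet _ _]addrC -!vl_leBlDr !vl_lexI !vl_leBlDr.
rewrite ![_ + u]addrC [w + v]addrC mvw andbT.
by rewrite !(le_trans mu) ?vl_leDl.
Qed.

Lemma vdisjointC x y : vdisjoint x y -> vdisjoint y x.
Proof. by rewrite /vdisjoint vmeetC. Qed.

Lemma vdisjoint0 x : vdisjoint 0 x.
Proof.
apply/le_anti; rewrite vl_lexI !vabs_ge0 andbT.
by rewrite -[leRHS]vabs0 vl_leIl.
Qed.

Lemma vdisjoint_le x y u v : vabs x <= vabs u -> vabs y <= vabs v ->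
  vdisjoint u v -> vdisjoint x y.
Proof.
move=> xu yv uv; apply/le_anti; rewrite vl_lexI !vabs_ge0 !andbT.
by rewrite -uv vl_leI2.
Qed.

Lemma vdisjointDr x y z : vdisjoint x y -> vdisjoint x z -> vdisjoint x (y + z).
Proof.
move=> xy xz; apply/le_anti; rewrite vl_lexI !vabs_ge0 !andbT.
have -> : (0 : V) = vmeet (vabs x) (vabs y) + vmeet (vabs x) (vabs z).
  by rewrite xy xz addr0.
apply: (le_trans _ (vmeetD_le _ _ _)); rewrite ?vabs_ge0//.
by rewrite vl_leI2 ?vabs_triangle.
Qed.

Lemma vdisjointDl x y z : vdisjoint x z -> vdisjoint y z -> vdisjoint (x + y) z.
Proof.
by move=> /vdisjointC xz /vdisjointC yz; apply/vdisjointC/vdisjointDr.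
Qed.

Lemma vdisjointNr x y : vdisjoint x y -> vdisjoint x (- y).
Proof. by rewrite /vdisjoint vabsN. Qed.

Lemma vdisjointxx x : vdisjoint x x -> x = 0.
Proof.
move=> xx; apply/vabs_eq0/le_anti; rewrite vabs_ge0 andbT -xx.
by rewrite vl_lexI lexx.
Qed.

Lemma vdisjoint_absD x y : vdisjoint x y -> vabs x <= vabs (x + y).
Proof.
move=> xy; have : vabs x <= vmeet (vabs x) (vabs (x + y) + vabs y).
  rewrite vl_lexI lexx /= -{1}(addrK y x).
  by rewrite (le_trans (vabs_triangle _ _))// vabsN.
move=> /le_trans/(_ (vmeetD_le (vabs_ge0 _) (vabs_ge0 _) (vabs_ge0 _))).
by rewrite [X in _ + X]xy addr0 vl_lexI => /andP[].
Qed.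

Lemma riesz_decomposition y u v : 0 <= u -> 0 <= v -> vabs y <= u + v ->
  exists y1 y2, [/\ y = y1 + y2, vabs y1 <= u & vabs y2 <= v].
Proof.
move=> u0 v0; rewrite vabs_le => /andP[lby yub].
have Nu : - u <= u by rewrite (@le_trans _ _ 0) // -vl_leN2 opprK oppr0.
have Nv : - v <= 0 by rewrite -vl_leN2 opprK oppr0.
set y1 := vjoin (vmeet y u) (- u); exists y1, (y - y1); split.
- by rewrite addrC subrK.
- by rewrite vabs_le vl_leUr /= vl_leUx vl_leIr Nu.
- have y1_le : y1 <= y + v.
    rewrite vl_leUx (le_trans (vl_leIl _ _)) ?vl_leDl//=.
    by rewrite -vl_leBlDr -opprD.
  have le_y1 : y - v <= y1.
    rewrite (le_trans _ (vl_leUl _ _))// vl_lexI !vl_leBlDr vl_leDl//=.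
  rewrite vabs_le vl_leBrDr addrC vl_leBlDr y1_le /=.
  by rewrite vl_leBlDr addrC -vl_leBlDr.
Qed.

(* [y] is a fragment (or component) of [x] *)
Definition fragment x y : Prop := vdisjoint y (x - y).

Lemma fragment0 x : fragment x 0.
Proof. exact: vdisjoint0. Qed.

Lemma fragmentxx x : fragment x x.
Proof. by apply/vdisjointC; rewrite subrr; exact: vdisjoint0. Qed.

Lemma fragment_abs x y : fragment x y -> vabs y <= vabs x.
Proof. by move=> /vdisjoint_absD; rewrite addrC subrK. Qed.

Lemma fragmentC x y : fragment x y -> fragment x (x - y).
Proof. by rewrite /fragment subKr => /vdisjointC. Qed.

Lemma fragmentD x1 x2 y1 y2 : vdisjoint x1 x2 ->
  fragment x1 y1 -> fragment x2 y2 -> fragment (x1 + x2) (y1 + y2).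
Proof.
move=> x12 f1 f2; rewrite /fragment opprD addrACA.
have h1 := fragment_abs f1; have h2 := fragment_abs f2.
have k1 := fragment_abs (fragmentC f1); have k2 := fragment_abs (fragmentC f2).
apply: vdisjointDl; apply: vdisjointDr => //.
- exact: vdisjoint_le x12.
- by apply: vdisjointC; exact: vdisjoint_le x12.
Qed.

Lemma fragment_split x1 x2 y : vdisjoint x1 x2 -> fragment (x1 + x2) y ->
  exists y1 y2,
    [/\ y = y1 + y2, fragment x1 y1, fragment x2 y2 & vdisjoint y1 y2].
Proof.
have split0 z : vdisjoint x1 x2 -> fragment (x1 + x2) z ->
    exists z1 z2, [/\ z = z1 + z2, vabs z1 <= vabs x1, vabs z2 <= vabs x2,
                      vabs z1 <= vabs z & vabs z2 <= vabs z].
  move=> x12 /fragment_abs xz.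
  have [z1 [z2 [zE z1x z2x]]] := riesz_decomposition (vabs_ge0 x1)
    (vabs_ge0 x2) (le_trans xz (vabs_triangle _ _)).
  have z12 : vdisjoint z1 z2 by exact: vdisjoint_le x12.
  exists z1, z2; split => //; rewrite zE; first exact: vdisjoint_absD.
  by rewrite addrC; exact/vdisjoint_absD/vdisjointC.
move=> x12 xy.
have [y1 [y2 [yE y1x y2x y1y y2y]]] := split0 _ x12 xy.
have [z1 [z2 [zE z1x z2x z1z z2z]]] := split0 _ x12 (fragmentC xy).
have sumE : (y1 + z1) + (y2 + z2) = x1 + x2.
  by rewrite addrACA -yE -zE addrC subrK.
pose d := x1 - (y1 + z1).
have dE : d = (y2 + z2) - x2.
  apply/eqP; rewrite /d subr_eq addrAC eq_sym subr_eq.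
  by rewrite addrC sumE.
have dx2 w : vabs w <= vabs x2 -> vdisjoint d w.
  move=> wx2.
  have dis u : vabs u <= vabs x1 -> vdisjoint u w.
    by move=> ux1; exact: vdisjoint_le x12.
  apply: vdisjointDl; first exact: dis.
  rewrite opprD; apply: vdisjointDl; apply: dis; by rewrite vabsN.
have d0 : d = 0.
  apply: vdisjointxx; rewrite {2}dE; apply: vdisjointDr.
    by apply: vdisjointDr; exact: dx2.
  by apply: dx2; rewrite vabsN.
have z1E : z1 = x1 - y1.
  by apply/eqP; rewrite -subr_eq0 -oppr_eq0 opprB -addrA -opprD -/d d0.
have z2E : z2 = x2 - y2.
  have /eqP := dE; rewrite d0 eq_sym subr_eq0 => /eqP <-.
  by rewrite addrC addKr.
exists y1, y2; split => //; last exact: vdisjoint_le x12.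
- by rewrite /fragment -z1E; exact: vdisjoint_le xy.
- by rewrite /fragment -z2E; exact: vdisjoint_le xy.
Qed.

Lemma order_bounded_setP (A : set V) :
  order_bounded_set A <-> exists w, 0 <= w /\ forall x, A x -> vabs x <= w.
Proof.
split=> [[[l lA] [h hA]]|[w [w0 Aw]]]; last first.
  by split; [exists (- w)|exists w] => x /Aw; rewrite vabs_le => /andP[].
exists (vabs l + vabs h); split; first by rewrite vl_addr_ge0 ?vabs_ge0.
move=> x Ax; rewrite vabs_le (le_trans (hA _ Ax)) ?andbT.
  rewrite (le_trans _ (lA _ Ax))// opprD vl_leBlDr.
  by rewrite (@le_trans _ _ l) ?vl_leDl ?vabs_ge0// vl_leNl vabs_geN.
by rewrite (le_trans (vabs_ge _))// addrC vl_leDl ?vabs_ge0.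
Qed.

End VectorLatticeTheory.

Lemma order_boundedP (R : realType) (E F : vectorLatticeType R) (T : E -> F) :
  order_bounded T <-> forall w : E, exists h : F, 0 <= h /\
    forall x, vabs x <= w -> vabs (T x) <= h.
Proof.
split=> [bT w|bT A /order_bounded_setP[w [w0 Aw]]].
- have /bT/order_bounded_setP[h [h0 hT]] :
      order_bounded_set [set x : E | vabs x <= w].
    by split; [exists (- w)|exists w] => x /=; rewrite vabs_le => /andP[].
  by exists h; split => // x xw; apply: hT; exists x.
- have [h [h0 hT]] := bT w.
  apply/order_bounded_setP; exists h; split => // _ [x Ax <-].
  by apply: hT; exact: Aw.
Qed.

Section Uryson.
Context {R : realType}.
Variables E F : vectorLatticeType R.

Definition uryson_pred : {pred E -> F} :=
  fun T => `[< orthogonally_additive T /\ order_bounded T >].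

Lemma uryson_submod_closed : submod_closed uryson_pred.
Proof.
split.
  apply/asboolP; split=> [x y _|]; first by rewrite addr0.
  apply/order_boundedP => w; exists 0; split => // x _.
  by rewrite vabs0.
move=> a S T /asboolP[oaS bS] /asboolP[oaT bT]; apply/asboolP; split.
  by move=> x y xy /=; rewrite !fctE oaS// oaT// scalerDr addrACA.
have {}bT : forall w, exists h : F, 0 <= h /\
  forall x, vabs x <= w -> vabs (T x) <= h by exact/order_boundedP.
have {}bS : forall w, exists h : F, 0 <= h /\
  forall x, vabs x <= w -> vabs (S x) <= h by exact/order_boundedP.
apply/order_boundedP => w.
have [h [h0 Sh]] := bS w; have [k [k0 Tk]] := bT w.
exists (`|a| *: h + k); split.
  by rewrite vl_addr_ge0// -(scaler0 _ `|a|) vl_leZ.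
move=> x xw; rewrite !fctE (le_trans (vabs_triangle _ _))// vl_leD2 ?Tk//.
by rewrite (le_trans (vabsZ_le _ _))// vl_leZ// Sh.
Qed.

HB.instance Definition _ :=
  GRing.isSubmodClosed.Build R (E -> F) uryson_pred uryson_submod_closed.

Record uryson := Uryson { uryson_fun :> E -> F; _ : uryson_fun \in uryson_pred }.

HB.instance Definition _ := [isSub for uryson_fun].
HB.instance Definition _ := [Choice of uryson by <:].
HB.instance Definition _ := [SubChoice_isSubLmodule of uryson by <:].

Implicit Types S T U : uryson.

Lemma uryson_oa T : orthogonally_additive T.
Proof. by case: T => T /= /asboolP[]. Qed.

Lemma uryson_ob T : order_bounded T.
Proof. by case: T => T /= /asboolP[]. Qed.

Lemma urysonP S T : S = T <-> forall x, S x = T x.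
Proof. by split=> [->//|ST]; apply/val_inj/funext. Qed.

Lemma uryson_addE S T x : (S + T) x = S x + T x. Proof. by []. Qed.
Lemma uryson_oppE T x : (- T) x = - T x. Proof. by []. Qed.
Lemma uryson_scaleE (a : R) T x : (a *: T) x = a *: T x. Proof. by []. Qed.
Lemma uryson_zeroE x : (0 : uryson) x = 0. Proof. by []. Qed.

Lemma uryson0 T : T 0 = 0.
Proof.
have := uryson_oa T (vdisjoint0 0); rewrite addr0 => /eqP.
by rewrite -subr_eq0 opprD addNKr oppr_eq0 => /eqP.
Qed.

Definition uryson_le S T := `[< forall x, S x <= T x >].

Fact uryson_le_refl : reflexive uryson_le.
Proof. by move=> T; apply/asboolP. Qed.

Fact uryson_le_anti : antisymmetric uryson_le.
Proof.
move=> S T /andP[/asboolP ST /asboolP TS]; apply/urysonP => x.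
by apply/le_anti; rewrite ST TS.
Qed.

Fact uryson_le_trans : transitive uryson_le.
Proof.
move=> T S U /asboolP ST /asboolP TU; apply/asboolP => x.
exact: le_trans (ST x) (TU x).
Qed.

HB.instance Definition _ := Order.Le_isPOrder.Build ring_display uryson
  uryson_le_refl uryson_le_anti uryson_le_trans.

Lemma uryson_leP S T : reflect (forall x, S x <= T x) (S <= T).
Proof. exact: asboolP. Qed.

End Uryson.

Section UrysonLattice.
Context {R : realType}.
Variables (E : vectorLatticeType R) (F : dedekindVectorLatticeType R).
Implicit Types S T U : uryson E F.

(* The positive part of [T] is x |-> sup { T y | y is a fragment of x }; joins
   and meets in [uryson E F] are obtained from it. *)
Definition uryson_pos_fun T (x : E) : F :=
  xget 0 (supremums [set T y | y in fragment x]).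

Lemma uryson_bounded_fragment T (w : E) : exists h : F, 0 <= h /\
  forall x y, vabs x <= w -> fragment x y -> T y <= h.
Proof.
have [+ _] := order_boundedP T => /(_ (@uryson_ob _ _ _ T) w)[h [h0 Th]].
exists h; split => // x y xw /fragment_abs yx.
by rewrite (le_trans (vabs_ge _))// Th// (le_trans yx).
Qed.

Lemma uryson_pos_funP T x :
  supremums [set T y | y in fragment x] (uryson_pos_fun T x).
Proof.
rewrite /uryson_pos_fun; case: xgetP => [y -> //|none].
have [] := @vl_sup_exists R F [set T y | y in fragment x].
- by exists (T x), x => //; exact: fragmentxx.
- have [h [_ Th]] := uryson_bounded_fragment T (vabs x).
  by exists h => _ [y xy <-]; exact: Th xy.
- by move=> s /none.
Qed.

Lemma uryson_pos_fun_ge T x y : fragment x y -> T y <= uryson_pos_fun T x.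
Proof. by move=> xy; have [ub _] := uryson_pos_funP T x; apply: ub; exists y. Qed.

Lemma uryson_pos_fun_le T x (h : F) :
  (forall y, fragment x y -> T y <= h) -> uryson_pos_fun T x <= h.
Proof.
move=> Th; have [_ lb] := uryson_pos_funP T x.
by apply: lb => _ [y xy <-]; exact: Th.
Qed.

Lemma uryson_pos_subproof T : uryson_pos_fun T \in @uryson_pred R E F.
Proof.
apply/asboolP; split.
- move=> x1 x2 x12; apply/le_anti/andP; split.
    apply: uryson_pos_fun_le => y /(fragment_split x12)[y1 [y2 [-> f1 f2 y12]]].
    by rewrite uryson_oa// vl_leD2// uryson_pos_fun_ge.
  rewrite -vl_leBrDr; apply: uryson_pos_fun_le => y1 f1.
  rewrite vl_leBrDr addrC -vl_leBrDr; apply: uryson_pos_fun_le => y2 f2.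
  rewrite vl_leBrDr addrC -uryson_oa.
    exact/uryson_pos_fun_ge/fragmentD.
  exact: vdisjoint_le (fragment_abs f1) (fragment_abs f2) x12.
- apply/order_boundedP => w; have [h [h0 Th]] := uryson_bounded_fragment T w.
  exists h; split => // x xw; rewrite vabs_le; apply/andP; split.
    rewrite (@le_trans _ _ 0)//; first by rewrite -vl_leN2 opprK oppr0.
    by rewrite -(uryson0 T) uryson_pos_fun_ge//; exact: fragment0.
  by apply: uryson_pos_fun_le => y; exact: Th.
Qed.

Definition uryson_pos T : uryson E F := Uryson (uryson_pos_subproof T).

Lemma uryson_pos_leP T U : (uryson_pos T <= U) = (0 <= U) && (T <= U).
Proof.
apply/idP/andP => [/uryson_leP TU|[/uryson_leP U0 /uryson_leP TU]].
- split; apply/uryson_leP => x; apply: le_trans (TU x).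
    by rewrite uryson_zeroE -(uryson0 T) uryson_pos_fun_ge//; exact: fragment0.
  by rewrite uryson_pos_fun_ge//; exact: fragmentxx.
- apply/uryson_leP => x; apply: uryson_pos_fun_le => y xy.
  rewrite (le_trans (TU y))// -[leRHS](_ : U (y + (x - y)) = _).
    by rewrite uryson_oa// vl_leDl// U0.
  by rewrite addrC subrK.
Qed.

Fact uryson_leD2r (U S T : uryson E F) : S <= T -> S + U <= T + U.
Proof.
by move=> /uryson_leP ST; apply/uryson_leP => x; rewrite !uryson_addE vl_leD2r.
Qed.

Fact uryson_leZ (a : R) S T : 0 <= a -> S <= T -> a *: S <= a *: T.
Proof.
by move=> a0 /uryson_leP ST; apply/uryson_leP => x; rewrite !uryson_scaleE vl_leZ.
Qed.

Fact uryson_leBlDr S T U : (S - T <= U) = (S <= U + T).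
Proof.
by apply/idP/idP => [/(uryson_leD2r T)|/(uryson_leD2r (- T))];
  rewrite ?subrK ?addrK.
Qed.

Fact uryson_leN2 S T : (- S <= - T) = (T <= S).
Proof.
by apply/uryson_leP/uryson_leP => ST x; have := ST x;
  rewrite !uryson_oppE vl_leN2.
Qed.

Definition uryson_join S T : uryson E F := uryson_pos (S - T) + T.
Definition uryson_meet S T : uryson E F := - uryson_join (- S) (- T).

Fact uryson_leUx S T U : (uryson_join S T <= U) = (S <= U) && (T <= U).
Proof.
rewrite /uryson_join -[X in _ + X]opprK uryson_leBlDr uryson_pos_leP.
rewrite uryson_leBlDr subrK andbC; congr (_ && _).
by rewrite -[in LHS](subrr T) uryson_leBlDr subrK.
Qed.

Fact uryson_lexI S T U : (S <= uryson_meet T U) = (S <= T) && (S <= U).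
Proof.
by rewrite -[S in LHS]opprK uryson_leN2 uryson_leUx !uryson_leN2.
Qed.

HB.instance Definition _ := isVectorLattice.Build R (uryson E F)
  uryson_lexI uryson_leUx uryson_leD2r uryson_leZ.

End UrysonLattice.

Section Tensor.
Context {R : realType} {E F : vectorLatticeType R}.
Variables (phi : uryson E R^o) (u : F).

Lemma tensor_subproof : (fun x => (phi x : R) *: u) \in @uryson_pred R E F.
Proof.
apply/asboolP; split=> [x y xy|]; first by rewrite uryson_oa// scalerDl.
apply/order_boundedP => w.
have [+ _] := order_boundedP phi => /(_ (@uryson_ob _ _ _ phi) w)[h [h0 phih]].
exists (h *: vabs u); split; first by rewrite -(scaler0 _ h) vl_leZ ?vabs_ge0.
move=> x /phih xh; rewrite (le_trans (vabsZ_le _ _))// -vl_subr_ge0 -scalerBl.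
rewrite -(scaler0 _ (h - `|phi x|)) vl_leZ ?vabs_ge0// subr_ge0.
by move: xh; rewrite vabs_le ler_norml.
Qed.

Definition tensor : uryson E F := Uryson tensor_subproof.

End Tensor.

(* Main.v *)
Require Import Defs.
From HB Require Import structures.
From mathcomp Require Import all_boot all_order all_algebra.
From mathcomp Require Import boolp classical_sets functions reals.

Set Implicit Arguments.
Unset Strict Implicit.
Unset Printing Implicit Defensive.

Import Order.TTheory GRing.Theory Num.Theory.

Local Open Scope ring_scope.
Local Open Scope classical_set_scope.

(** Since [T = tensor phi u], the modulus of [T] dominates [tensor |phi| |u|]
    ([tensor_vabs_le]). Let [Z] witness the finiteness of [T]: for each [S]
    there is [c > 0] with [|S| /\ n |T| <= c Z] for all [n]. Testing this on
    elementary tensors [S] separates the two factors.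

    With [S = tensor |phi| |w|] one gets
    [tensor |phi| (|w| /\ n |u|) <= |S| /\ n |T| <= c Z]. As [phi != 0], there
    is a point [x0] with [|phi| x0 > 0], and evaluation there shows that
    [(|phi| x0)^-1 Z x0] witnesses the finiteness of [u].

    With [S = tensor |psi| |u|] one gets
    [tensor (|psi| /\ n |phi|) |u| <= c Z]. Now [u] has to be removed by a
    positive functional that is positive at [|u|]. The order dual provides some
    order bounded [f] with [f u != 0], and its modulus [g = |f|] satisfies
    [g |u| >= |f u| > 0]. Applying [g] pointwise shows that
    [(g |u|)^-1 (g o Z)] witnesses the finiteness of [phi]. Since [Z >= 0], all
    this happens on the positive cone, where [g] is given by the
    Riesz-Kantorovich formula and is additive, positively homogeneous and
    monotone. *)

(** * Vector lattices *)

Section VectorLatticeComplements.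
Context {R : realType} {V : vectorLatticeType R}.
Implicit Types (x y v w : V) (a b : R).

Lemma vl_leMn x y n : x <= y -> x *+ n <= y *+ n.
Proof. by move=> xy; rewrite -!scaler_nat vl_leZ. Qed.

Lemma vl_leZr v a b : 0 <= v -> a <= b -> a *: v <= b *: v.
Proof.
move=> v0 ab; rewrite -vl_subr_ge0 -scalerBl -(scaler0 _ (b - a)).
by rewrite vl_leZ// subr_ge0.
Qed.

Lemma vl_scale_ge0 a x : 0 <= a -> 0 <= x -> 0 <= a *: x.
Proof. by move=> a0 x0; rewrite -(scaler0 _ a) vl_leZ. Qed.

Lemma vl_leZV a x y : 0 < a -> a *: x <= y -> x <= a^-1 *: y.
Proof.
move=> a0 /(@vl_leZ _ _ a^-1 _ _); rewrite invr_ge0 ltW// => /(_ isT).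
by rewrite scalerA mulVf ?scale1r// gt_eqF.
Qed.

(** In other words [a *: |v| <= |a *: v|], where the sign of [a] matters: for
    [a <= 0] the left side is nonpositive. *)
Lemma vabs_scale_le a v w : a *: v <= w -> - (a *: v) <= w ->
  a *: vabs v <= w.
Proof.
move=> avw Navw; have [a0|a0] := ler0P a; last first.
  rewrite -[w]scale1r -(mulfV (lt0r_neq0 a0)) -scalerA vl_leZ ?(ltW a0)//.
  by rewrite vl_leUx !vl_leZV// scalerN.
have w0 : 0 <= w.
  by apply: le_trans (vabs_ge0 (a *: v)) _; rewrite vl_leUx avw.
by apply: le_trans w0; rewrite -(scale0r (vabs v)) vl_leZr ?vabs_ge0.
Qed.

End VectorLatticeComplements.

Section DedekindComplements.
Context {R : realType} {F : dedekindVectorLatticeType R}.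
Implicit Types (v w : F) (A : set R).

(** The supremum [s] of the multiples of [x] satisfies [s <= s - x], because
    each [x *+ n + x] is again a multiple. *)
Lemma dedekind_archimedean (x y : F) : (forall n, x *+ n <= y) -> x <= 0.
Proof.
move=> xy; have [||s [ubs lbs]] := @vl_sup_exists R F (range (fun n => x *+ n)).
- by exists 0, 0.
- by exists y => _ [n _ <-].
have /lbs : ubound (range (fun n => x *+ n)) (s - x).
  by move=> _ [n _ <-]; rewrite vl_leBrDr -mulrSr; apply: ubs; exists n.+1.
by rewrite vl_leBrDr addrC -vl_leBrDr subrr.
Qed.

(** [s *: v - w] is dominated by every [n.+1%:R^-1 *: v], as [A] comes within
    [n.+1%:R^-1] of [s]; so it is nonpositive by the Archimedean property. *)
Lemma scale_supremum_le (A : set R^o) (s : R^o) v w : supremums A s -> 0 <= v ->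
  (forall a : R, A a -> a *: v <= w) -> (s : R) *: v <= w.
Proof.
move=> [_ lbs] v0 Avw; rewrite -[leLHS](subrK w) -[leRHS]add0r vl_leD2r//.
apply: (@dedekind_archimedean _ v) => n.
have [a Aa sa] : exists2 a : R, A a & (s : R) - n.+1%:R^-1 < a.
  apply: contrapT => noa.
  have : ubound A ((s : R) - n.+1%:R^-1 : R^o).
    by move=> a Aa /=; rewrite leNgt; apply/negP => sa; apply: noa; exists a.
  by move=> /lbs; rewrite lerBrDr -lerBrDl subrr leNgt invr_gt0 ltr0n.
have svw : (s : R) *: v - w <= n.+1%:R^-1 *: v.
  rewrite vl_leBlDr (le_trans (vl_leZr v0 (b := n.+1%:R^-1 + a) _))//.
    by rewrite -lerBlDl ltW.
  by rewrite scalerDl vl_leD2 ?Avw.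
apply: le_trans (vl_leMn n svw) _; rewrite -scaler_nat scalerA.
by rewrite -[leRHS]scale1r vl_leZr// ler_pdivrMr ?ltr0n// mul1r ler_nat.
Qed.

End DedekindComplements.

(** * Elementary tensors *)

Section TensorOrder.
Context {R : realType} {E : vectorLatticeType R}.
Context {F : dedekindVectorLatticeType R}.
Implicit Types (phi psi : uryson E R^o) (u v : F) (W : uryson E F).

Lemma tensorE phi u x : tensor phi u x = (phi x : R) *: u.
Proof. by []. Qed.

Lemma tensor_le phi psi v : 0 <= v -> phi <= psi -> tensor phi v <= tensor psi v.
Proof.
by move=> v0 /uryson_leP phipsi; apply/uryson_leP => x; rewrite vl_leZr ?phipsi.
Qed.

Lemma tensorMn phi u n : tensor (phi *+ n) u = tensor phi u *+ n.
Proof.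
apply/urysonP => x.
by rewrite -!scaler_nat uryson_scaleE !tensorE uryson_scaleE scalerA.
Qed.

(** A positive [W] takes at [x] a value at least as large as at any fragment of
    [x], so it dominates the supremum over fragments that defines the positive
    part. *)
Lemma tensor_pos_le phi v W : 0 <= v -> 0 <= W -> tensor phi v <= W ->
  tensor (uryson_pos phi) v <= W.
Proof.
move=> v0 /uryson_leP W0 /uryson_leP phiW; apply/uryson_leP => x.
apply: (scale_supremum_le (uryson_pos_funP phi x)) => // _ [y xy <-].
apply: le_trans (phiW y) _; rewrite -[leRHS](_ : W (y + (x - y)) = _).
  by rewrite uryson_oa// vl_leDl// W0.
by rewrite addrC subrK.
Qed.

(** Translation by [tensor psi v] reduces this to [tensor_pos_le], since
    [vjoin phi psi] is by definition [uryson_pos (phi - psi) + psi]. *)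
Lemma tensor_join_le phi psi v W : 0 <= v -> tensor phi v <= W ->
  tensor psi v <= W -> tensor (vjoin phi psi) v <= W.
Proof.
move=> v0 phiW psiW; have tensorB (f g : uryson E R^o) :
    tensor (f - g) v = tensor f v - tensor g v.
  by apply/urysonP => x; rewrite !tensorE scalerBl.
have tensorD (f g : uryson E R^o) : tensor (f + g) v = tensor f v + tensor g v.
  by apply/urysonP => x; rewrite !tensorE scalerDl.
rewrite [vjoin _ _]/(uryson_pos (phi - psi) + psi) tensorD -vl_leBrDr.
by apply: tensor_pos_le; rewrite ?vl_subr_ge0// tensorB vl_leD2r.
Qed.

Lemma tensor_vabs_le phi u : tensor (vabs phi) (vabs u) <= vabs (tensor phi u).
Proof.
have /uryson_leP le1 := vabs_ge (tensor phi u).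
have /uryson_leP le2 := vabs_geN (tensor phi u).
apply: tensor_join_le; first exact: vabs_ge0.
  by apply/uryson_leP => x; apply: vabs_scale_le; [exact: le1|exact: le2].
apply/uryson_leP => x; rewrite tensorE uryson_oppE.
by apply: vabs_scale_le; rewrite scaleNr ?opprK; [exact: le2|exact: le1].
Qed.

(** The two estimates that turn the finiteness condition on [tensor phi u] into
    a condition on one factor: the elementary tensor on the left splits off
    [vabs u], respectively [vabs phi]. *)
Lemma tensor_meet_le phi psi u n :
  tensor (vmeet (vabs psi) (vabs phi *+ n)) (vabs u)
    <= vmeet (vabs (tensor (vabs psi) (vabs u))) (vabs (tensor phi u) *+ n).
Proof.
rewrite vl_lexI; apply/andP; split.
  apply: le_trans (vabs_ge _); apply: tensor_le; first exact: vabs_ge0.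
  exact: vl_leIl.
apply: (@le_trans _ _ (tensor (vabs phi *+ n) (vabs u))).
  by apply: tensor_le; [exact: vabs_ge0|exact: vl_leIr].
by rewrite tensorMn vl_leMn ?tensor_vabs_le.
Qed.

Lemma meet_tensor_le phi u w n :
  tensor (vabs phi) (vmeet (vabs w) (vabs u *+ n))
    <= vmeet (vabs (tensor (vabs phi) (vabs w))) (vabs (tensor phi u) *+ n).
Proof.
have /uryson_leP phi0 := vabs_ge0 phi.
have mono v v' : v <= v' -> tensor (vabs phi) v <= tensor (vabs phi) v'.
  by move=> vv'; apply/uryson_leP => x; apply: vl_leZ => //; exact: phi0.
rewrite vl_lexI; apply/andP; split.
  by apply: le_trans (vabs_ge _); apply: mono; exact: vl_leIl.
have -> : vabs (tensor phi u) *+ n = n%:R *: vabs (tensor phi u).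
  by rewrite scaler_nat.
apply: (@le_trans _ _ (tensor (vabs phi) (vabs u *+ n))).
  by apply: mono; exact: vl_leIr.
have -> : tensor (vabs phi) (vabs u *+ n) = n%:R *: tensor (vabs phi) (vabs u).
  apply/urysonP => x.
  by rewrite uryson_scaleE !tensorE -scaler_nat !scalerA mulrC.
by rewrite vl_leZ// tensor_vabs_le.
Qed.

End TensorOrder.

(** * The modulus of an order bounded functional *)

Section FunctionalModulus.
Context {R : realType} {F : vectorLatticeType R}.
Variable f : {linear F -> R^o}.
Hypothesis f_bounded : order_bounded f.
Implicit Types (u v w y : F) (a : R).

(** The Riesz-Kantorovich formula for [|f|], meaningful for [0 <= v]. *)
Definition modulus v : R := sup [set (f y : R) | y in [set y | vabs y <= v]].

Lemma modulus_ge v y : vabs y <= v -> f y <= modulus v.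
Proof.
move=> yv; have /order_boundedP/(_ v)[h [_ fh]] := f_bounded.
apply: (@ub_le_sup R); last by exists y.
by exists h => _ [z zv <-]; apply: le_trans (fh z zv); exact: vabs_ge.
Qed.

Lemma modulus_le v b : 0 <= v -> (forall y, vabs y <= v -> (f y : R) <= b) ->
  modulus v <= b.
Proof.
move=> v0 fb; apply: ge_sup; last by move=> _ [y yv <-]; exact: fb.
by exists (f 0), 0 => //=; rewrite vabs0.
Qed.

Lemma modulus_ge0 v : 0 <= v -> 0 <= modulus v.
Proof. by move=> v0; rewrite -[0](linear0 f) modulus_ge// vabs0. Qed.

Lemma modulus_mono v w : 0 <= v -> v <= w -> modulus v <= modulus w.
Proof.
by move=> v0 vw; apply: modulus_le => // y yv; rewrite modulus_ge// (le_trans yv).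
Qed.

(** The inequality [<=] comes from splitting [y] along [v + w] by the Riesz
    decomposition property. *)
Lemma modulusD v w : 0 <= v -> 0 <= w -> modulus (v + w) = modulus v + modulus w.
Proof.
move=> v0 w0; apply/le_anti/andP; split.
  apply: modulus_le => [|y yvw]; first exact: vl_addr_ge0.
  have [y1 [y2 [-> y1v y2w]]] := riesz_decomposition v0 w0 yvw.
  by rewrite linearD; apply: lerD; exact: modulus_ge.
rewrite -lerBrDr; apply: modulus_le => // y yv.
rewrite lerBrDr addrC -lerBrDr; apply: modulus_le => // z zw.
rewrite lerBrDr -[X in X <= _](linearD f) modulus_ge// addrC.
by rewrite (le_trans (vabs_triangle _ _))// vl_leD2.
Qed.

Lemma modulusZ a v : 0 <= a -> 0 <= v -> modulus (a *: v) = a * modulus v.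
Proof.
have scale_le (b : R) w : 0 < b -> 0 <= w -> b * modulus w <= modulus (b *: w).
  move=> b0 w0; rewrite -ler_pdivlMl//; apply: modulus_le => // y yw.
  rewrite ler_pdivlMl//; have -> : b * f y = f (b *: y) by rewrite linearZ.
  apply: modulus_ge; rewrite (le_trans (vabsZ_le _ _))// gtr0_norm//.
  by rewrite vl_leZ// ltW.
rewrite le_eqVlt => /predU1P[<- v0|a0 v0].
  rewrite scale0r mul0r; apply/le_anti; rewrite modulus_ge0// andbT.
  apply: modulus_le => // y y0; rewrite (@vabs_eq0 _ _ y) ?linear0//.
  by apply/le_anti; rewrite y0 vabs_ge0.
apply/le_anti; rewrite scale_le// andbT -ler_pdivrMl//.
apply: le_trans (scale_le _ _ _ _) _; rewrite ?invr_gt0//.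
  by rewrite vl_scale_ge0// ltW.
by rewrite scalerA mulVf ?scale1r// gt_eqF.
Qed.

Lemma modulus_gt0 u : f u != 0 -> 0 < modulus (vabs u).
Proof.
move=> fu; have : (0 : R) < `|f u : R| by rewrite normr_gt0.
move=> /lt_le_trans; apply; rewrite ler_norml; apply/andP; split.
  rewrite lerNl -[X in X <= _](linearN f).
  by apply: modulus_ge; rewrite vabsN.
exact: modulus_ge.
Qed.

Lemma modulus_uryson_subproof {E : vectorLatticeType R} (Z : uryson E F) :
  0 <= Z -> (fun x => modulus (Z x) : R^o) \in @uryson_pred R E R^o.
Proof.
move=> /uryson_leP Z0; apply/asboolP; split=> [x y xy|].
  by rewrite uryson_oa// modulusD// Z0.
apply/order_boundedP => w.
have /order_boundedP/(_ w)[h [h0 Zh]] := uryson_ob Z.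
exists (modulus h); split; first exact: modulus_ge0.
move=> x xw; rewrite vabs_le; apply/andP; split.
  apply: (@le_trans _ _ (0 : R^o)); last by apply: modulus_ge0; exact: Z0.
  by rewrite oppr_le0; exact: modulus_ge0.
apply: modulus_mono; first exact: Z0.
exact: le_trans (vabs_ge _) (Zh x xw).
Qed.

Definition modulus_uryson {E : vectorLatticeType R} (Z : uryson E F)
  (Z0 : 0 <= Z) : uryson E R^o := Uryson (modulus_uryson_subproof Z0).

End FunctionalModulus.

(** * Finite rank one operators *)

Section RankOne.
Context {R : realType} {E : vectorLatticeType R}.
Context {F : dedekindVectorLatticeType R}.
Variables (phi : uryson E R^o) (u : F).
Hypothesis phiu_finite : finite_elements (uryson E F) (tensor phi u).

Lemma finite_functional (f : {linear F -> R^o}) :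
  order_bounded f -> f u != 0 -> finite_elements (uryson E R^o) phi.
Proof.
move=> fb /(modulus_gt0 fb) gu0; have [Z ZP] := phiu_finite.
have Z0 : 0 <= Z.
  (* every c *: Z dominates a meet of positive operators *)
  have [c c0 /(_ 0)] := ZP 0; rewrite vabs0 mulr0n => Zc.
  have /(vl_leZV c0) : c *: (0 : uryson E F) <= c *: Z.
    by rewrite scaler0; apply: le_trans Zc; rewrite vl_lexI lexx.
  by move=> /le_trans; apply; rewrite scalerA mulVf ?scale1r ?gt_eqF.
exists ((modulus f (vabs u))^-1 *: modulus_uryson fb Z0) => psi.
have [c c0 cP] := ZP (tensor (vabs psi) (vabs u)); exists c => // n.
set m := vmeet _ _.
have /uryson_leP m0 : 0 <= m.
  by rewrite vl_lexI vabs_ge0 -(mul0rn _ n) vl_leMn// vabs_ge0.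
have /uryson_leP muZ := le_trans (tensor_meet_le phi psi u n) (cP n).
have /uryson_leP Zx0 := Z0.
apply/uryson_leP => x; rewrite !uryson_scaleE.
have : modulus f ((m x : R) *: vabs u) <= modulus f (c *: Z x).
  apply: (modulus_mono fb); last exact: muZ.
  by apply: vl_scale_ge0; [exact: m0|exact: vabs_ge0].
rewrite (modulusZ fb (m0 x) (vabs_ge0 u)) (modulusZ fb (ltW c0) (Zx0 x)).
by rewrite -ler_pdivlMr// -mulrA [_ / _]mulrC.
Qed.

Lemma finite_vector : phi != 0 -> finite_elements F u.
Proof.
move=> phi0; have [Z ZP] := phiu_finite.
have [x x0] : exists x, 0 < (vabs phi x : R).
  apply: contrapT => nox; move/eqP: phi0; apply; apply/vabs_eq0/le_anti.
  rewrite vabs_ge0 andbT; apply/uryson_leP => x.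
  by rewrite [_ <= _]leNgt; apply/negP => x0; apply: nox; exists x.
exists ((vabs phi x : R)^-1 *: Z x) => w.
have [c c0 cP] := ZP (tensor (vabs phi) (vabs w)); exists c => // n.
have /uryson_leP/(_ x) := le_trans (meet_tensor_le phi u w n) (cP n).
by rewrite tensorE => /(vl_leZV x0); rewrite uryson_scaleE !scalerA mulrC.
Qed.

End RankOne.

Theorem theorem5p2 (R : realType) (E : vectorLatticeType R)
    (F : dedekindVectorLatticeType R)
    (hF : order_dual_separates_points F)
    (phi : uryson E R^o) (u : F) (T : uryson E F)
    (T_neq0 : T != 0) (T_tensor : T = tensor phi u)
    (T_finite : finite_elements (uryson E F) T) :
  finite_elements (uryson E R^o) phi /\ finite_elements F u.
Proof.
subst T; have phi_neq0 : phi != 0.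
  apply: contraNneq T_neq0 => ->.
  by apply/eqP/urysonP => x; rewrite tensorE scale0r.
have u_neq0 : u != 0.
  apply: contraNneq T_neq0 => ->.
  by apply/eqP/urysonP => x; rewrite tensorE scaler0.
have [f [f_bounded fu_neq0]] := hF u u_neq0.
split; first exact: finite_functional f_bounded fu_neq0.
exact: finite_vector phi_neq0.
Qed.
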